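(* For all integers $n\ge 0$ and $\alpha\ge 0$, \[\overline{p}\big(4^{\alpha}(40n+35)\big)\equiv 0 \pmod{40}.\] In particular (case $\alpha=0$), $\overline{p}(40n+35)\equiv 0 \pmod{40}$ for all $n\ge 0$.
   Context: An overpartition of a nonnegative integer $n$ is a partition of $n$ in which the first occurrence of each distinct part may (or may not) be overlined; $\overline{p}(n)$ denotes the number of overpartitions of $n$ (with $\overline{p}(0)=1$). Equivalently, $\sum_{n\ge0}\overline{p}(n)q^n=\prod_{k\ge1}\frac{1+q^k}{1-q^k}$. *)

(* Defs.v *)
From mathcomp Require Import all_boot.
Set Implicit Arguments. Unset Strict Implicit. Unset Printing Implicit Defensive.

Fixpoint parts_le (fuel m n : nat) : seq (seq nat) :=
  match fuel with
  | 0 => if n == 0 then [:: [::]] else [::]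
  | fuel'.+1 =>
    if n == 0 then [:: [::]] else
    flatten [seq [seq k :: l | l <- parts_le fuel' k (n - k)]
            | k <- iota 1 (minn m n)]
  end.

Definition partitions (n : nat) : seq (seq nat) := parts_le n n n.

Definition is_partition (n : nat) (l : seq nat) : bool :=
  [&& sorted geq l, all (fun k => 0 < k) l & sumn l == n].

(* An overpartition of n is a partition of n together with a choice, for each
   distinct part, of whether its first occurrence is overlined.  Hence the
   number of overpartitions of n is the sum over partitions of n of
   2^(number of distinct parts). *)
Definition pbar (n : nat) : nat :=
  \sum_(l <- partitions n) 2 ^ size (undup l).

(* Main.v *)
Require Import Defs.
From mathcomp Require Import all_boot all_algebra.
From mathcomp Require Import zify ring.

(** By Gauss, [sum pbar(n) q^n = 1 / A] with [A = sum_(k in Z) (-q)^(k^2)].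

    Modulo 8: [A = 1 + 2 S], so [1 / A = A^2 - 3 A + 3] up to [8 S^3 / A], and
    its coefficient at [m] vanishes when [m] is not a sum of two squares.

    Modulo 5: [A(q)^5 = A(q^5)], so extracting the exponents divisible by 5 in
    [A(q)^5 / A(q) = A(q)^4] gives
    [A(q) * sum pbar(5n) q^n = sum (-1)^n r_4(5n) q^n].  Counting quaternions by
    their left divisors of norm 5 gives [r_4(5n) = r_4(n) mod 5], so the right
    side is [A^4] and [pbar(5n) = (-1)^n r_3(n) mod 5], which vanishes for
    [n = 4^a (8k + 7)]. *)

Set Implicit Arguments.
Unset Strict Implicit.
Unset Printing Implicit Defensive.
Import GRing.Theory.

(** * Overpartitions with bounded parts *)

Lemma parts_le_fuel f m n : n <= f -> parts_le f m n = parts_le n m n.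
Proof.
elim/ltn_ind: n f m => n IH [|f] m; first by rewrite leqn0 => /eqP ->.
case: n IH => [|n] IH //= le_nf; congr flatten; apply/eq_in_map => k.
rewrite mem_iota => hk; congr map.
rewrite (IH (n.+1 - k)) ?(IH (n.+1 - k) _ n) //; lia.
Qed.

Lemma parts_le_bound f m n l k : l \in parts_le f m n -> k \in l -> k <= m.
Proof.
elim: f m n l => [|f IH] m n l /=; case: ifP => _ //; rewrite ?inE.
- by move/eqP->.
- by move/eqP->.
case/flatten_mapP=> j; rewrite mem_iota => hj /mapP[l' /IH hl' ->].
rewrite inE => /orP[/eqP->|/hl']; lia.
Qed.

(** The first part runs upward through [iota 1 (minn m n)], so raising the bound only appends the
    lists that begin with [m.+1]. *)
Lemma parts_leS f m n : n <= f ->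
  parts_le f m.+1 n = parts_le f m n ++
    (if m < n then [seq m.+1 :: l | l <- parts_le f m.+1 (n - m.+1)] else [::]).
Proof.
move=> le_nf; rewrite [X in map _ X]parts_le_fuel; last by lia.
case: f n le_nf => [|f] [|n] // le_nf; set r := parts_le (_ - _) _ _.
rewrite /=; case: ltnP => hmn; last first.
  by rewrite cats0 !(minn_idPr _) // ltnW.
rewrite !(minn_idPl _) ?(ltnW hmn) //.
have -> : iota 1 m.+1 = iota 1 m ++ [:: m.+1] by rewrite -[in LHS](addn1 m) iotaD add1n.
rewrite map_cat flatten_cat /= cats0; congr (_ ++ map _ _).
by rewrite parts_le_fuel //; lia.
Qed.

Definition overpart_le (m n : nat) : nat :=
  \sum_(l <- parts_le n m n) 2 ^ size (undup l).

Lemma overpart_leE f m n : n <= f ->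
  overpart_le m n = \sum_(l <- parts_le f m n) 2 ^ size (undup l).
Proof. by move=> le_nf; rewrite (parts_le_fuel m le_nf). Qed.

Lemma overpart_le0 n : overpart_le 0 n = (n == 0).
Proof.
by case: n => [|n]; rewrite /overpart_le /= ?min0n ?big_nil // big_seq1.
Qed.

(** Prefixing [m.+1] doubles the weight of [l] when this part is new and keeps it otherwise, so the
    lists with all parts at most [m] are counted once more. *)
Lemma overpart_cons m n f : n <= f ->
  \sum_(l <- parts_le f m.+1 n) 2 ^ size (undup (m.+1 :: l)) =
  overpart_le m.+1 n + overpart_le m n.
Proof.
move=> le_nf; rewrite !(overpart_leE _ le_nf) parts_leS // !big_cat /=.
rewrite [in LHS]big_seq (eq_bigr (fun l => 2 * 2 ^ size (undup l))); last first.
  move=> l hl; case: ifP => [hm|_] /=; last by rewrite expnS.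
  by have := parts_le_bound hl hm; rewrite ltnn.
rewrite -big_seq -big_distrr /=.
set B := (X in _ + X = _); set C := (X in _ = (_ + X) + _).
suff -> : B = C by lia.
rewrite /B /C; case: ifP => _; rewrite ?big_nil // !big_map.
by apply: eq_bigr => l _; rewrite inE eqxx.
Qed.

(** Coefficient form of [(1 - q^(m+1)) F_(m+1) = (1 + q^(m+1)) F_m], where [F_m] is the generating
    function of [overpart_le m]. *)
Lemma overpart_leS m n : overpart_le m.+1 n =
  overpart_le m n +
  (if m < n then overpart_le m.+1 (n - m.+1) + overpart_le m (n - m.+1) else 0).
Proof.
rewrite {1}/overpart_le parts_leS // big_cat /=; congr addn.
by case: ifP => _; rewrite ?big_nil // big_map overpart_cons // leq_subr.
Qed.

Lemma overpart_le_pbar m n : n <= m -> overpart_le m n = pbar n.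
Proof.
rewrite leq_eqVlt => /orP[/eqP-> //|]; elim: m => // m IH.
rewrite ltnS overpart_leS ltnNge => le_nm; rewrite le_nm addn0.
by move: le_nm; rewrite leq_eqVlt => /orP[/eqP-> //|/IH].
Qed.

Local Open Scope ring_scope.

(** * A finite Gauss identity *)

Section FiniteGauss.
Variables (R : comNzRingType) (q : R).

(** In q-Pochhammer notation, these are [(-q; q)_n] and, for [s <= n], the quotient
    [(q; q)_n / (q; q)_s]. *)
Definition plus_prod n := \prod_(1 <= i < n.+1) (1 + q ^+ i).
Definition minus_prod s n := \prod_(s.+1 <= i < n.+1) (1 - q ^+ i).

Lemma plus_prodS n : plus_prod n.+1 = plus_prod n * (1 + q ^+ n.+1).
Proof. by rewrite /plus_prod big_nat_recr. Qed.

Lemma minus_prodS s n : (s <= n)%N ->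
  minus_prod s n.+1 = minus_prod s n * (1 - q ^+ n.+1).
Proof. by move=> le_sn; rewrite /minus_prod big_nat_recr. Qed.

Lemma minus_prod_recl s n : (s < n)%N ->
  minus_prod s n = (1 - q ^+ s.+1) * minus_prod s.+1 n.
Proof. by move=> lt_sn; rewrite /minus_prod big_ltn. Qed.

Lemma minus_prodnn n : minus_prod n n = 1.
Proof. by rewrite /minus_prod big_geq. Qed.

Lemma signr_sqr n : (-1) ^+ (n ^ 2) = (-1) ^+ n :> R.
Proof. by rewrite -signr_odd oddX signr_odd. Qed.

(* A finite form of Gauss's identity in the style of Shanks: every term of the
   right-hand sum is divisible by [q ^+ n.+1]. *)
Lemma finite_gauss n :
  (1 + 2%:R * \sum_(s < n) (- q) ^+ (s.+1 ^ 2)) * plus_prod n =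
  minus_prod 0 n +
  2%:R * \sum_(t < n)
    (-1) ^+ t.+1 * q ^+ (t.+1 * n.+1) * plus_prod t * minus_prod t.+1 n.
Proof.
elim: n => [|n IH].
  by rewrite !big_ord0 /plus_prod /minus_prod !big_geq // !mulr0 !addr0 mulr1.
rewrite big_ord_recr /= plus_prodS.
transitivity ((1 + 2%:R * \sum_(s < n) (- q) ^+ (s.+1 ^ 2)) * plus_prod n
    * (1 + q ^+ n.+1) +
    2%:R * (- q) ^+ (n.+1 ^ 2) * plus_prod n * (1 + q ^+ n.+1)); first by ring.
rewrite IH exprNn signr_sqr.
rewrite [in RHS]big_ord_recr /= minus_prodnn minus_prodS //.
set Q := q ^+ n.+1.
(* Telescoping certificate: passing from [n] to [n.+1] multiplies the [t]-th summand by [1 + Q] up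
   to [b t - b t.+1]. The boundary term [b 0] turns the factor [1 + Q] of [minus_prod 0 n] into
   [1 - Q], and [b n] accounts for the new square exponent. *)
pose b t := (-1) ^+ t * Q ^+ t.+1 * plus_prod t * minus_prod t n.
have tele : \sum_(t < n) (b t - b t.+1) = b 0%N - b n.
  rewrite -(big_mkord xpredT (fun t => b t - b t.+1)) -[RHS]opprB.
  by rewrite -(telescope_sumr _ (leq0n n)) -sumrN; apply: eq_bigr => i _; rewrite opprB.
have step : \sum_(t < n)
    (-1) ^+ t.+1 * q ^+ (t.+1 * n.+2) * plus_prod t * minus_prod t.+1 n.+1 =
  (1 + Q) * \sum_(t < n)
    (-1) ^+ t.+1 * q ^+ (t.+1 * n.+1) * plus_prod t * minus_prod t.+1 n +
  \sum_(t < n) (b t - b t.+1).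
  rewrite mulr_sumr -big_split /=; apply: eq_bigr => t _.
  rewrite /b minus_prodS // plus_prodS (minus_prod_recl (ltn_ord t)) -/Q.
  rewrite [(t.+1 * n.+2)%N]mulnS exprD (mulnC t.+1 n.+1) exprM -/Q.
  by rewrite !exprS; ring.
rewrite step tele /b minus_prodnn /plus_prod [\prod_(1 <= i < 1) _]big_geq //.
rewrite -/(plus_prod n) mulnS exprD -mulnn exprM -/Q !exprS.
rewrite expr0.
ring.
Qed.
End FiniteGauss.

(** * Truncated power series *)

Section TruncatedSeries.
Variable R : comNzRingType.
Implicit Types d p r : {poly R}.

(** Congruence modulo [q^N]: polynomials stand in for truncated power series. *)
Definition eq_upto N p r := forall i, (i < N)%N -> p`_i = r`_i.

Lemma eq_upto_sym N p r : eq_upto N p r -> eq_upto N r p.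
Proof. by move=> h i hi; rewrite h. Qed.

Lemma eq_upto_trans N r p s : eq_upto N p r -> eq_upto N r s -> eq_upto N p s.
Proof. by move=> h1 h2 i hi; rewrite h1 ?h2. Qed.

Lemma eq_uptoM N p p' r r' :
  eq_upto N p p' -> eq_upto N r r' -> eq_upto N (p * r) (p' * r').
Proof.
move=> hp hr i hi; rewrite !coefM; apply: eq_bigr => j _.
by rewrite hp ?hr //; have := ltn_ord j; lia.
Qed.

Lemma eq_uptoMl N p r r' : eq_upto N r r' -> eq_upto N (p * r) (p * r').
Proof. by move=> h; apply: eq_uptoM. Qed.

Lemma eq_upto_cancel N d p r :
  d`_0 = 1 -> eq_upto N (d * p) (d * r) -> eq_upto N p r.
Proof.
move=> d0 h; elim/ltn_ind => i IH hi; have := h i hi.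
rewrite !coefM !big_ord_recl !subn0 d0 !mul1r.
rewrite (eq_bigr (fun j : 'I_i => d`_(lift ord0 j) * r`_(i - lift ord0 j))).
  by move/addIr.
by move=> j _; rewrite IH // lift0; have := ltn_ord j; lia.
Qed.

(** * Overpartition generating functions and the theta series *)

Definition overpart_poly N m : {poly R} := \poly_(n < N) (overpart_le m n)%:R.

Lemma overpart_polyS N m :
  eq_upto N ((1 - 'X^(m.+1)) * overpart_poly N m.+1)
            ((1 + 'X^(m.+1)) * overpart_poly N m).
Proof.
move=> n hn; rewrite mulrBl mulrDl !mul1r coefB coefD ![_ * overpart_poly _ _]mulrC.
rewrite !coefMXn !coef_poly hn ltnS (leq_ltn_trans (leq_subr _ _) hn).
rewrite overpart_leS; case: leqP => _; last by rewrite !natrD; ring.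
by rewrite addn0 subr0 addr0.
Qed.

Lemma overpart_poly_prod N m :
  eq_upto N (minus_prod 'X 0 m * overpart_poly N m) (plus_prod 'X m).
Proof.
elim: m => [|m IH].
  move=> n hn; rewrite /minus_prod /plus_prod !big_geq // mul1r coef_poly hn.
  by rewrite overpart_le0 coef1.
rewrite minus_prodS // plus_prodS -mulrA.
apply: eq_upto_trans (eq_uptoMl _ (@overpart_polyS N m)) _.
rewrite mulrCA mulrC; exact: eq_uptoM.
Qed.

(** The integers from [-K] to [K]; [Negz i] is [-(i+1)], so zero is listed only once. *)
Definition theta_box K : seq int :=
  [seq Posz i | i <- iota 0 K.+1] ++ [seq Negz i | i <- iota 0 K].

Definition theta K : {poly R} := \sum_(k <- theta_box K) (- 'X) ^+ (`|k| ^ 2).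

Lemma thetaE K : theta K = 1 + 2%:R * \sum_(s < K) (- 'X) ^+ (s.+1 ^ 2).
Proof.
rewrite /theta big_cat /= big_cons expr0 -addrA !big_map; congr (_ + _).
have -> : iota 0 K = index_iota 0 K by rewrite /index_iota subn0.
rewrite -(addn0 1%N) iotaDl big_map -{1}[K]subn0.
by rewrite !big_mkord /= mulr_natl mulr2n.
Qed.

Lemma theta_gauss K :
  eq_upto K.+1 (theta K * plus_prod 'X K) (minus_prod 'X 0 K).
Proof.
move=> i hi; rewrite thetaE finite_gauss coefD -[RHS]addr0; congr (_ + _).
rewrite mulr_natl coefMn coef_sum big1 ?mul0rn // => t _.
rewrite -!mulrA mulrCA mulrC coefMXn.
by rewrite ifT //; nia.
Qed.

Definition pbar_poly N : {poly R} := \poly_(n < N) (pbar n)%:R.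

Lemma pbar_theta K : eq_upto K.+1 (pbar_poly K.+1 * theta K) 1.
Proof.
have -> : pbar_poly K.+1 = overpart_poly K.+1 K.
  by apply/polyP => i; rewrite !coef_poly; case: ltnP => // hi; rewrite overpart_le_pbar.
(* Multiplied by this product, the left side becomes [plus_prod 'X K * theta K], to which Gauss's
   identity applies. *)
apply: (@eq_upto_cancel _ (minus_prod 'X 0 K)).
  rewrite /minus_prod -horner_coef0 horner_prod big_nat big1 // => i hi.
  by rewrite !hornerE expr0n; case: i hi => // i; rewrite subr0.
rewrite mulr1 mulrA.
apply: eq_upto_trans (eq_uptoM (@overpart_poly_prod _ _) (fun _ _ => erefl)) _.
rewrite mulrC; exact: theta_gauss.
Qed.
End TruncatedSeries.

Lemma mem_theta_box K (k : int) : (k \in theta_box K) = (`|k| <= K)%N.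
Proof.
rewrite mem_cat; case: k => k; apply/idP/idP.
- case/orP=> /mapP[j]; rewrite mem_iota => hj //= [->]; lia.
- by move=> hk; apply/orP; left; apply: map_f; rewrite mem_iota.
- case/orP=> /mapP[j]; rewrite mem_iota => hj //= [->]; lia.
- by move=> hk; apply/orP; right; apply: map_f; rewrite mem_iota.
Qed.

Lemma theta_box_uniq K : uniq (theta_box K).
Proof.
rewrite cat_uniq !map_inj_uniq ?iota_uniq; try by move=> ? ? [].
by rewrite andbT; apply/hasPn => _ /mapP[j _ ->]; apply/mapP => -[].
Qed.

Section ThetaCoef.
Variable R : comNzRingType.

Lemma coefNXn m i : ((- 'X) ^+ m : {poly R})`_i = (-1) ^+ m * (i == m)%:R.
Proof. by rewrite -scaleN1r exprZn coefZ coefXn. Qed.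

Lemma theta_coef_eq0 K m : (forall a, a ^ 2 <> m)%N -> (theta R K)`_m = 0.
Proof.
move=> h; rewrite coef_sum big1 // => k _; rewrite coefNXn.
by case: eqP => [e|_]; [case: (h `|k|%N) | rewrite mulr0].
Qed.

Lemma theta2_coef_eq0 K m :
  (forall a b, a ^ 2 + b ^ 2 <> m)%N -> (theta R K ^+ 2)`_m = 0.
Proof.
move=> h; rewrite expr2 /theta big_distrlr coef_sum big1 // => a _.
rewrite coef_sum big1 // => b _; rewrite /= -exprD coefNXn.
by case: eqP => [e|_]; [case: (h `|a|%N `|b|%N) | rewrite mulr0].
Qed.

Lemma theta3_coef_eq0 K m :
  (forall a b c, a ^ 2 + b ^ 2 + c ^ 2 <> m)%N -> (theta R K ^+ 3)`_m = 0.
Proof.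
move=> h; rewrite exprSr expr2 /theta big_distrlr mulr_suml coef_sum big1 // => a _.
rewrite big_distrlr coef_sum big1 // => b _.
rewrite coef_sum big1 // => c _; rewrite /= -!exprD coefNXn.
by case: eqP => [e|_]; [case: (h `|a|%N `|b|%N `|c|%N) | rewrite mulr0].
Qed.

End ThetaCoef.

(** * Sums of two and three squares *)

Lemma sqrn_mod4 a : (a ^ 2 %% 4 = odd a)%N.
Proof.
rewrite -[in LHS](odd_double_half a); move: (a./2) => b.
case: (odd a); rewrite /= ?add1n ?add0n -muln2.
  by have -> : ((1 + b * 2) ^ 2 = (b * b + b) * 4 + 1)%N; [ring | rewrite modnMDl].
by rewrite expnMn modnMl.
Qed.

Lemma odd_sqrn_mod8 a : odd a -> (a ^ 2 %% 8 = 1)%N.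
Proof.
move=> oa; rewrite -(odd_double_half a) oa; move: (a./2) => b.
have -> : ((true + b.*2) ^ 2 = 4 * (b * b.+1) + 1)%N by rewrite /= -muln2; ring.
have /dvdnP[c ->] : (2 %| b * b.+1)%N by rewrite dvdn2 oddM /=; case: odd.
by rewrite [(4 * _)%N]mulnC -mulnA modnMDl.
Qed.

Lemma even_sqrn a : ~~ odd a -> (a ^ 2 = 4 * a./2 ^ 2)%N.
Proof. by move=> oa; rewrite -{1}(odd_double_half a) (negPf oa) add0n -mul2n expnMn. Qed.

(** Descent on [t]: two squares whose sum is divisible by 4 are both even, and a sum of two squares
    is never 3 modulo 4. *)
Lemma two_squares_neq a b t n : (a ^ 2 + b ^ 2 <> 4 ^ t * (4 * n + 3))%N.
Proof.
elim: t a b => [|t IH] a b e; have := sqrn_mod4 a; have := sqrn_mod4 b.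
  by rewrite expn0 in e; case: (odd a); case: (odd b); lia.
rewrite [(4 ^ _)%N]expnS -mulnA in e; set M := (4 ^ t * _)%N in e.
case oa: (odd a); case ob: (odd b); try lia.
move=> _ _; apply: (IH a./2 b./2).
move: e; rewrite (even_sqrn (negbT oa)) (even_sqrn (negbT ob)); lia.
Qed.

(** The same descent; at the bottom, a sum that is 3 modulo 4 forces three odd squares, whose sum is
    3 rather than 7 modulo 8. *)
Lemma three_squares_neq a b c t n :
  (a ^ 2 + b ^ 2 + c ^ 2 <> 4 ^ t * (8 * n + 7))%N.
Proof.
elim: t a b c => [|t IH] a b c e;
  have := sqrn_mod4 a; have := sqrn_mod4 b; have := sqrn_mod4 c.
  rewrite expn0 in e.
  have := @odd_sqrn_mod8 a; have := @odd_sqrn_mod8 b; have := @odd_sqrn_mod8 c.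
  case: (odd a); case: (odd b); case: (odd c) => /= h1 h2 h3;
  try (have := h1 isT); try (have := h2 isT); try (have := h3 isT); lia.
rewrite [(4 ^ _)%N]expnS -mulnA in e; set M := (4 ^ t * _)%N in e.
case oa: (odd a); case ob: (odd b); case oc: (odd c); try lia.
move=> _ _ _; apply: (IH a./2 b./2 c./2).
move: e; rewrite (even_sqrn (negbT oa)) (even_sqrn (negbT ob)) (even_sqrn (negbT oc)); lia.
Qed.

(** * Divisibility by 8 *)

Lemma pbar_dvdn8 m : (forall a b, a ^ 2 + b ^ 2 <> m)%N -> (8 %| pbar m)%N.
Proof.
move=> h; pose A := theta int m; pose P := pbar_poly int m.+1.
pose S : {poly int} := \sum_(s < m) (- 'X) ^+ (s.+1 ^ 2).
have eA : A = 1 + 2%:R * S by rewrite /A thetaE.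
(* The quadratic comes from [A (A^2 - 3 A + 3) = 1 + (A - 1)^3 = 1 + 8 S^3]. *)
have := eq_uptoM (@pbar_theta int m) (fun _ _ => erefl (A ^+ 2 - 3%:R * A + 3%:R)`_ _).
move/(_ m (ltnSn m)); rewrite mul1r -/A -/P.
have -> : P * A * (A ^+ 2 - 3%:R * A + 3%:R) = P + (P * S ^+ 3) *+ 8.
  by rewrite eA; ring.
rewrite coefD coefMn coef_poly ltnSn !coefD coefN !mulr_natl coefMn.
rewrite theta2_coef_eq0 // theta_coef_eq0; last by move=> a; have := h a 0%N; rewrite addn0.
(* The constant 3 contributes only at [m = 0], which is itself a sum of two squares. *)
rewrite coef1; case: eqP => [m0|_]; first by have := h 0%N 0%N; rewrite m0.
by rewrite mul0rn; lia.
Qed.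

(** * Representations by four squares modulo 5 *)

(** Quaternions [a + b i + c j + d k] with integer coordinates; the nesting in pairs matches the
    expansion of [theta ^+ 4] as the square of [theta ^+ 2]. *)
Notation quat := ((int * int) * (int * int))%type.

Definition qmul (x y : quat) : quat :=
  let: ((a, b), (c, d)) := x in let: ((e, f), (g, h)) := y in
  ((a * e - b * f - c * g - d * h, a * f + b * e + c * h - d * g),
   (a * g - b * h + c * e + d * f, a * h + b * g - c * f + d * e)).

Definition qconj (x : quat) : quat :=
  let: ((a, b), (c, d)) := x in ((a, - b), (- c, - d)).

Definition qscale (k : int) (x : quat) : quat :=
  let: ((a, b), (c, d)) := x in ((k * a, k * b), (k * c, k * d)).

Definition qdvd (k : int) (x : quat) : bool :=
  let: ((a, b), (c, d)) := x in
  [&& (k %| a)%Z, (k %| b)%Z, (k %| c)%Z & (k %| d)%Z].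

Definition qnorm (x : quat) : nat :=
  (`|x.1.1| ^ 2 + `|x.1.2| ^ 2 + (`|x.2.1| ^ 2 + `|x.2.2| ^ 2))%N.

Lemma qnormE x : (qnorm x)%:Z =
  x.1.1 ^+ 2 + x.1.2 ^+ 2 + (x.2.1 ^+ 2 + x.2.2 ^+ 2).
Proof.
have sq (a : int) : (`|a| ^ 2)%N%:Z = a ^+ 2 by rewrite -abszX; lia.
by rewrite !PoszD !sq.
Qed.

Lemma qnormM x y : qnorm (qmul x y) = (qnorm x * qnorm y)%N.
Proof.
apply/eqP; rewrite -eqz_nat PoszM !qnormE; apply/eqP.
by case: x y => [[a b] [c d]] [[e f] [g h]] /=; ring.
Qed.

Lemma qconjK x : qconj (qconj x) = x.
Proof. by case: x => [[a b] [c d]]; rewrite /= !opprK. Qed.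

Lemma qnorm_conj x : qnorm (qconj x) = qnorm x.
Proof. by case: x => [[a b] [c d]]; rewrite /qnorm /= !abszN. Qed.

Lemma qmul_conj x y : qmul (qconj x) (qmul x y) = qscale (qnorm x) y.
Proof.
case: x y => [[a b] [c d]] [[e f] [g h]]; rewrite /qscale qnormE /=.
by congr ((_, _), (_, _)); ring.
Qed.

Lemma qmulZ k x y : qmul x (qscale k y) = qscale k (qmul x y).
Proof.
case: x y => [[a b] [c d]] [[e f] [g h]] /=.
by congr ((_, _), (_, _)); ring.
Qed.

Lemma qscale_inj k : k != 0 -> injective (qscale k).
Proof.
move=> k0 [[a b] [c d]] [[e f] [g h]] [] /(mulfI k0) -> /(mulfI k0) ->.
by move=> /(mulfI k0) -> /(mulfI k0) ->.
Qed.

Lemma qdvdP k x : reflect (exists y, x = qscale k y) (qdvd k x).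
Proof.
case: x => [[a b] [c d]]; apply: (iffP and4P).
  case=> /dvdzP[e ->] /dvdzP[f ->] /dvdzP[g ->] /dvdzP[h ->].
  by exists ((e, f), (g, h)); rewrite /= ![k * _]mulrC.
by case=> -[[e f] [g h]] [-> -> -> ->]; rewrite !dvdz_mulr.
Qed.

Definition quat_box K : seq quat :=
  [seq (u, v) | u <- [seq (a, b) | a <- theta_box K, b <- theta_box K],
                v <- [seq (c, d) | c <- theta_box K, d <- theta_box K]].

Definition quats K m : seq quat := [seq x <- quat_box K | qnorm x == m].

Lemma quats_uniq K m : uniq (quats K m).
Proof.
by rewrite filter_uniq // !allpairs_uniq ?theta_box_uniq // => -[? ?] [? ?] _ _ [-> ->].
Qed.

(** Each coordinate is bounded by its square, hence by [m], so the box misses no quaternion of norm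
    [m] and [size (quats K m)] is [r_4(m)]. *)
Lemma mem_quats K m x : (m <= K)%N -> (x \in quats K m) = (qnorm x == m).
Proof.
move=> le_mK; rewrite mem_filter; case: eqP => //= e.
have sq a : (a <= a ^ 2)%N by case: a => // a; rewrite -mulnn leq_pmulr.
case: x e => [[a b] [c d]]; rewrite /qnorm /= => e.
have := sq `|a|%N; have := sq `|b|%N; have := sq `|c|%N; have := sq `|d|%N => *.
by apply: allpairs_f; apply: allpairs_f; rewrite mem_theta_box; lia.
Qed.

(* One generator for each of the six right ideals of norm 5. *)
Definition norm5 : seq quat :=
  [:: ((1, 2), (0, 0)); ((1, -2), (0, 0)); ((1, 0), (2, 0));
      ((1, 0), (-2, 0)); ((1, 0), (0, 2)); ((1, 0), (0, -2))].

Lemma qnorm_norm5 p : p \in norm5 -> qnorm p = 5%N.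
Proof. by rewrite !inE; do ![case/orP]; move/eqP->. Qed.

(** Left multiplication by [p] is a bijection from the quaternions of norm [n] onto the counted
    ones: as [p] has norm 5, the inverse map sends [x] to [qmul (qconj p) x] divided by 5. *)
Lemma count_norm5_mul K n p : p \in norm5 -> (5 * n <= K)%N ->
  count (fun x => qdvd 5 (qmul (qconj p) x)) (quats K (5 * n)) =
  size (quats K n).
Proof.
move=> /qnorm_norm5 hp hK; rewrite -size_filter -[in RHS](size_map (qmul p)).
apply: perm_size; apply: uniq_perm.
- by rewrite filter_uniq ?quats_uniq.
- rewrite map_inj_uniq ?quats_uniq // => x y /(congr1 (qmul (qconj p))).
  by rewrite !qmul_conj hp => /qscale_inj; apply.
move=> x; rewrite mem_filter mem_quats //; apply/andP/mapP.
  case=> /qdvdP[y ey] /eqP ex.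
  have exy : x = qmul p y.
    apply: (@qscale_inj 5) => //; rewrite -qmulZ -ey -{1}(qconjK p) qmul_conj.
    by rewrite qnorm_conj hp.
  exists y => //; rewrite mem_quats; last by lia.
  by move: ex; rewrite exy qnormM hp; lia.
case=> y; rewrite mem_quats; last by lia.
move=> /eqP ey ->; rewrite qnormM hp ey; split=> //.
by apply/qdvdP; exists y; rewrite qmul_conj hp.
Qed.

Definition qdivisors5 x := count (fun p => qdvd 5 (qmul (qconj p) x)) norm5.

Definition residues5 : seq int := [:: 0; 1; 2; 3; 4].

(* Modulo 5, the zero quaternion lies in all six ideals and a nonzero quaternion
   of norm zero in exactly one. *)
Lemma qdivisors5_residues :
  all (fun u => all (fun v =>
      (5 %| qnorm (u, v))%N ==> (qdivisors5 (u, v) %% 5 == 1)%N)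
    [seq (c, d) | c <- residues5, d <- residues5])
    [seq (a, b) | a <- residues5, b <- residues5].
Proof. by vm_compute. Qed.

Definition qmod5 (x : quat) : quat :=
  let: ((a, b), (c, d)) := x in
  (((a %% 5)%Z, (b %% 5)%Z), ((c %% 5)%Z, (d %% 5)%Z)).

Lemma qdvd_mod5 p x : qdvd 5 (qmul p (qmod5 x)) = qdvd 5 (qmul p x).
Proof.
have key (u v w : int) : u = 5 * w + v -> (5 %| v)%Z = (5 %| u)%Z by lia.
case: p x => [[a b] [c d]] [[e f] [g h]] /=.
rewrite [in RHS](divz_eq e 5) [in RHS](divz_eq f 5).
rewrite [in RHS](divz_eq g 5) [in RHS](divz_eq h 5).
move: (e %% 5)%Z (f %% 5)%Z (g %% 5)%Z (h %% 5)%Z => e0 f0 g0 h0.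
move: (e %/ 5)%Z (f %/ 5)%Z (g %/ 5)%Z (h %/ 5)%Z => e1 f1 g1 h1.
(* By linearity in the second factor, the products before and after reduction differ by [5 y]. *)
pose y := qmul ((a, b), (c, d)) ((e1, f1), (g1, h1)).
by congr [&& _, _, _ & _]; [apply: (key _ _ y.1.1) | apply: (key _ _ y.1.2)
  | apply: (key _ _ y.2.1) | apply: (key _ _ y.2.2)]; rewrite /y /=; ring.
Qed.

Lemma qnorm_mod5 x : (5 %| qnorm (qmod5 x))%N = (5 %| qnorm x)%N.
Proof.
have sq (a : int) : exists w, a ^+ 2 = 5 * w + (a %% 5)%Z ^+ 2.
  exists (5 * (a %/ 5)%Z ^+ 2 + 2 * (a %/ 5)%Z * (a %% 5)%Z).
  by rewrite [in LHS](divz_eq a 5); ring.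
have := qnormE x; have := qnormE (qmod5 x); case: x => [[a b] [c d]] /=.
have [[u ->] [v ->]] := (sq a, sq b); have [[w ->] [z ->]] := (sq c, sq d).
by move: (qnorm _) (qnorm _) => m n; lia.
Qed.

Lemma qdivisors5_mod x : (5 %| qnorm x)%N -> (qdivisors5 x = 1 %[mod 5])%N.
Proof.
rewrite -qnorm_mod5 => hx.
have -> : qdivisors5 x = qdivisors5 (qmod5 x).
  by apply: eq_count => p; rewrite qdvd_mod5.
have res (a : int) : (a %% 5)%Z \in residues5.
  by rewrite !inE; lia.
move: hx; case: x => [[a b] [c d]] /=.
have /allP/(_ ((a %% 5)%Z, (b %% 5)%Z) (allpairs_f _ (res a) (res b))) := qdivisors5_residues.
move=> /allP/(_ ((c %% 5)%Z, (d %% 5)%Z) (allpairs_f _ (res c) (res d))).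
by move=> /implyP h /h /eqP.
Qed.

(** Double counting of pairs of a quaternion of norm [5 n] and a left divisor in [norm5]: each of
    the six divisors contributes [r_4(n)], while each quaternion contributes 1 modulo 5. *)
Lemma quats_mul5 K n : (5 * n <= K)%N ->
  size (quats K (5 * n)) = size (quats K n) %[mod 5].
Proof.
move=> hK.
have e : (\sum_(x <- quats K (5 * n)) qdivisors5 x = 6 * size (quats K n))%N.
  under eq_bigr do rewrite /qdivisors5 -sum1_count big_mkcond.
  rewrite exchange_big /=.
  under eq_big_seq => p hp do rewrite -big_mkcond sum1_count (count_norm5_mul hp hK).
  by rewrite big_const_seq count_predT iter_addn_0 mulnC.
have -> : size (quats K n) = (6 * size (quats K n))%N %[mod 5].
  by lia.
rewrite -e -sum1_size -modn_summ -[RHS]modn_summ; congr (_ %% 5)%N.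
rewrite big_seq [RHS]big_seq; apply: eq_bigr => x.
rewrite mem_filter => /andP[/eqP ex _].
by rewrite qdivisors5_mod // ex dvdn_mulr.
Qed.

Lemma theta4_coef (R : comNzRingType) K m :
  (theta R K ^+ 4)`_m = (-1) ^+ m * (size (quats K m))%:R.
Proof.
have -> : theta R K ^+ 4 = \sum_(x <- quat_box K) (- 'X) ^+ qnorm x.
  rewrite -[4%N]/(2 * 2)%N exprM expr2.
  have -> : theta R K ^+ 2 =
    \sum_(u <- [seq (a, b) | a <- theta_box K, b <- theta_box K])
      (- 'X) ^+ (`|u.1| ^ 2 + `|u.2| ^ 2).
    rewrite expr2 /theta big_distrlr big_allpairs /=.
    by apply: eq_bigr => a _; apply: eq_bigr => b _; rewrite exprD.
  rewrite big_distrlr [RHS]big_allpairs /=.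
  by apply: eq_bigr => a _; apply: eq_bigr => b _; rewrite -exprD.
rewrite coef_sum size_filter -sum1_count natr_sum mulr_sumr [RHS]big_mkcond /=.
apply: eq_bigr => x _; rewrite coefNXn eq_sym.
by case: eqP => [->|_]; rewrite ?mulr0.
Qed.

(** * Divisibility by 5 *)

Lemma pchar_F5 : 5%N \in [pchar {poly 'F_5}].
Proof. by rewrite pchar_poly pchar_Fp. Qed.

Lemma theta_exp5 K :
  theta 'F_5 K ^+ 5 = \sum_(k <- theta_box K) (- 'X) ^+ (5 * `|k| ^ 2).
Proof.
rewrite -(pFrobenius_autE pchar_F5) rmorph_sum.
by apply: eq_bigr => k _; rewrite mulnC exprM.
Qed.

Lemma signr_mul5 (R : pzRingType) n : (-1) ^+ (5 * n) = (-1) ^+ n :> R.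
Proof. by rewrite -signr_odd oddM signr_odd. Qed.

Lemma coefM_NXn (R : comNzRingType) (p : {poly R}) m i :
  (p * (- 'X) ^+ m)`_i = (-1) ^+ m * (if (i < m)%N then 0 else p`_(i - m)).
Proof. by rewrite -scaleN1r exprZn -scalerAr coefZ coefMXn. Qed.

Lemma pbar_mul5 K m : (5 * m <= K)%N ->
  (pbar (5 * m))%:R = (theta 'F_5 K ^+ 3)`_m.
Proof.
move=> hK; pose A := theta 'F_5 K; pose P := pbar_poly 'F_5 K.+1.
pose P5 : {poly 'F_5} := \poly_(n < m.+1) (pbar (5 * n))%:R.
have PA : eq_upto K.+1 (P * A) 1 := @pbar_theta _ K.
have PA' : eq_upto m.+1 (P * A) 1 by move=> i hi; apply: PA; lia.
have P5A : eq_upto m.+1 (P5 * A) (A ^+ 4).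
  (* Only exponents divisible by 5 occur in [A ^+ 5], so its product with [P] at [5 * i] involves
     only the coefficients of [P] kept in [P5]; the signs agree because 5 is odd. *)
  move=> i hi; transitivity ((P * A ^+ 5)`_(5 * i)).
    rewrite theta_exp5 /A /theta !mulr_sumr !coef_sum; apply: eq_bigr => k _.
    rewrite !coefM_NXn signr_mul5.
    rewrite ltn_pmul2l //; case: ltnP => // hk.
    rewrite -mulnBr !coef_poly ifT ?ifT //; lia.
  (* Here [P * A] is replaced by 1 up to exponent [5 * i], which is at most [K] because [i <= m]. *)
  rewrite exprS mulrA  (eq_uptoM PA (fun _ _ => erefl _)) ?mul1r; last by lia.
  rewrite !theta4_coef signr_mul5; congr (_ * _).
  have p5 : prime 5 by [].
  by rewrite -(Fp_nat_mod p5) quats_mul5 ?(Fp_nat_mod p5) //; lia.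
have : eq_upto m.+1 P5 (A ^+ 3).
  (* One factor [A] is cancelled through its inverse [P]:
     [P5 = P5 * A * P = A ^+ 4 * P = A ^+ 3]. *)
  rewrite -[P5]mulr1 -[A ^+ 3]mulr1.
  apply: eq_upto_trans (eq_uptoMl _ (eq_upto_sym PA')) _.
  rewrite [P * A]mulrC mulrA.
  apply: eq_upto_trans (eq_uptoM P5A (fun _ _ => erefl _)) _.
  by rewrite exprSr -mulrA [A * P]mulrC; apply: eq_uptoMl.
by move/(_ m (ltnSn m)) <-; rewrite coef_poly ltnSn.
Qed.

Lemma pbar_dvdn5 m :
  (forall a b c, a ^ 2 + b ^ 2 + c ^ 2 <> m)%N -> (5 %| pbar (5 * m))%N.
Proof.
move=> h; rewrite (dvdn_pcharf (pchar_Fp (isT : prime 5))).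
by rewrite (pbar_mul5 (leqnn _)) theta3_coef_eq0.
Qed.

Local Close Scope ring_scope.

Theorem theorem2 (n alpha : nat) :
  pbar (4 ^ alpha * (40 * n + 35)) = 0 %[mod 40].
Proof.
apply/eqP; rewrite mod0n -/(dvdn _ _) (@Gauss_dvd 8 5) //; apply/andP; split.
  apply: pbar_dvdn8 => a b; have -> : 40 * n + 35 = 4 * (10 * n + 8) + 3 by lia.
  exact: two_squares_neq.
have -> : 4 ^ alpha * (40 * n + 35) = 5 * (4 ^ alpha * (8 * n + 7)) by lia.
apply: pbar_dvdn5 => a b c; exact: three_squares_neq.
Qed.
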